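(* Let $1\leq p\leq q\leq\infty$. For a locally convex space $E$ the following assertions are equivalent: (i) every $(p,q)$-limited subset (resp., $(p,q)$-$\mathcal{E}$-limited subset) of $E$ is precompact; (ii) each operator $T:L\to E$ from a locally convex space $L$ to $E$ which transforms bounded subsets of $L$ to $(p,q)$-limited subsets (resp., $(p,q)$-$\mathcal{E}$-limited subsets) of $E$, transforms bounded subsets of $L$ to precompact subsets of $E$; (iii) each operator $T:L\to E$ from a normed space $L$ to $E$ which transforms bounded subsets of $L$ to $(p,q)$-limited subsets (resp., $(p,q)$-$\mathcal{E}$-limited subsets) of $E$, transforms bounded subsets of $L$ to precompact subsets of $E$. If in addition $E$ is locally complete, then (i)--(iii) are equivalent to (iv) each operator $T:L\to E$ from a Banach space $L$ to $E$ which transforms bounded subsets of $L$ to $(p,q)$-limited subsets (resp., $(p,q)$-$\mathcal{E}$-limited subsets) of $E$, transforms bounded subsets of $L$ to precompact subsets of $E$.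
   Context: All locally convex spaces are Hausdorff, over $\mathbb{F}\in\{\mathbb{R},\mathbb{C}\}$; $\omega=\{0,1,2,\dots\}$; ''operator'' means continuous linear map; subsets are non-empty. $E'$ is the topological dual of $E$. Precompact means totally bounded. $E$ is locally complete if the closed absolutely convex hull of each null sequence in $E$ is compact. A sequence $\{\chi_n\}_{n\in\omega}$ in $E'$ is weak$^\ast$ $p$-summable if $(\langle\chi_n,x\rangle)_n\in\ell_p$ (or $\in c_0$ if $p=\infty$) for every $x\in E$. With $\|\chi\|_A:=\sup\{|\chi(x)|:x\in A\cup\{0\}\}$, a non-empty subset $A$ of $E$ is $(p,q)$-limited (resp., $(p,q)$-$\mathcal{E}$-limited) if $(\|\chi_n\|_A)_n\in\ell_q$ if $q<\infty$, or $\|\chi_n\|_A\to0$ if $q=\infty$, for every (resp., every equicontinuous) weak$^\ast$ $p$-summable sequence $\{\chi_n\}$ in $E'$. The ''resp.'' version of the theorem replaces ''$(p,q)$-limited'' by ''$(p,q)$-$\mathcal{E}$-limited'' throughout all items. *)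

(* Defs.v *)
From HB Require Import structures.
From mathcomp Require Import all_boot all_order all_algebra.
From mathcomp Require Import complex.
From mathcomp Require Import all_classical all_reals all_analysis.

Set Implicit Arguments.
Unset Strict Implicit.
Unset Printing Implicit Defensive.

Import Order.TTheory GRing.Theory Num.Theory.
Import numFieldNormedType.Exports.

Local Open Scope classical_set_scope.
Local Open Scope ring_scope.

Variant scalar_kind := RealScalars | ComplexScalars.

Definition scalars (R : realType) (k : scalar_kind) : numFieldType :=
  match k with
  | RealScalars => R
  | ComplexScalars => complex R
  end.

(** The norm [`|z|] of a [numFieldType] takes its values in the field itself;
    [modulus] is the same norm with values in [R]. *)
Definition modulus (R : realType) (k : scalar_kind) : scalars R k -> R :=
  match k return scalars R k -> R with
  | RealScalars => fun x : R => `|x|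
  | ComplexScalars => fun z : complex R => complex.Re `|z|
  end.

Section LocallyConvex.
Context {K : numFieldType} {E : tvsType K}.
Implicit Types A B C U : set E.

(** The entourages of a [tvsType] form some uniformity that induces the topology,
    not necessarily the translation-invariant one, and the library's
    [precompact] means relatively compact: hence a definition from the
    neighbourhoods of 0. *)
Definition totally_bounded A : Prop :=
  forall U, nbhs (0 : E) U ->
    exists2 F : set E, finite_set F &
      A `<=` \bigcup_(x in F) [set x + u | u in U].

(** The library's [bounded_set] is about a norm. *)
Definition tvs_bounded B : Prop :=
  forall U, nbhs (0 : E) U ->
    exists2 r : K, 0 < r & B `<=` [set r *: u | u in U].

Definition absolutely_convex C : Prop :=
  forall (x y : E) (a b : K), C x -> C y -> `|a| + `|b| <= 1 ->
    C (a *: x + b *: y).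

Definition closed_absconvex_hull A : set E :=
  smallest [set C | closed C /\ absolutely_convex C] A.

End LocallyConvex.

Definition locally_complete (K : numFieldType) (E : tvsType K) : Prop :=
  forall x : nat -> E, x @ \oo --> (0 : E) ->
    compact (closed_absconvex_hull (range x)).

(** For nonnegative [u]: [u] is in l_p if [p] is finite, in c_0 if [p] is
    infinite. *)
Definition lp_or_c0 (R : realType) (p : \bar R) (u : nat -> \bar R) : Prop :=
  match p with
  | r%:E => ('N[counting]_r%:E [u] < +oo)%E
  | +oo%E => u @ \oo --> 0%E
  | -oo%E => False
  end.

Section Limited.
Context {R : realType} {k : scalar_kind} {E : tvsType (scalars R k)}.
Local Notation K := (scalars R k).
Implicit Types (p q : \bar R) (A : set E) (chi : nat -> {linear E -> K^o}).

Definition dual_sequence chi : Prop := forall n, continuous (chi n).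

Definition weakstar_summable p chi : Prop :=
  forall x : E, lp_or_c0 p (fun n => (modulus (chi n x))%:E).

Definition dual_seminorm A (f : E -> K) : \bar R :=
  ereal_sup [set (modulus (f x))%:E | x in A `|` [set 0]].

Definition limited p q A : Prop :=
  A !=set0 /\
  forall chi, dual_sequence chi -> weakstar_summable p chi ->
    lp_or_c0 q (fun n => dual_seminorm A (chi n)).

Definition E_limited p q A : Prop :=
  A !=set0 /\
  forall chi, dual_sequence chi ->
    equicontinuous [set: nat] (fun n => chi n : E -> K^o) ->
    weakstar_summable p chi ->
    lp_or_c0 q (fun n => dual_seminorm A (chi n)).

End Limited.

Section Operators.
Context {K : numFieldType} {E : tvsType K}.
Implicit Types (P Q lim : set E -> Prop).

Definition maps_bounded_to P (L : tvsType K) (T : L -> E) : Prop :=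
  forall B : set L, B !=set0 -> tvs_bounded B -> P (T @` B).

Definition sets_precompact lim : Prop :=
  forall A : set E, lim A -> totally_bounded A.

Definition lcs_operators_precompact lim : Prop :=
  forall (L : tvsType K) (T : {linear L -> E}),
    hausdorff_space L -> continuous T ->
    maps_bounded_to lim T -> maps_bounded_to totally_bounded T.

Definition normed_operators_precompact lim : Prop :=
  forall (L : normedModType K) (T : {linear L -> E}), continuous T ->
    maps_bounded_to lim T -> maps_bounded_to totally_bounded T.

Definition banach_operators_precompact lim : Prop :=
  forall (L : completeNormedModType K) (T : {linear L -> E}), continuous T ->
    maps_bounded_to lim T -> maps_bounded_to totally_bounded T.

End Operators.

(* Main.v *)
From HB Require Import structures.
Require Import Defs.
From mathcomp Require Import all_boot all_order all_algebra.
From mathcomp Require Import complex.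
From mathcomp Require Import all_classical all_reals all_analysis.
From mathcomp Require Import ring lra.

(** Only two implications have content: from operators on normed spaces to
    sets, and from operators on Banach spaces to sets when [E] is locally
    complete.  Let [A] be a limited subset of [E], in either sense, and let
    [D] be its closed absolutely convex hull.  The linear span of [D], normed
    by the Minkowski gauge of [D], is a normed space [disk_space D]: [D] is
    bounded and [E] is Hausdorff, so that [D] contains no line and the gauge
    vanishes only at 0.  The inclusion of [disk_space D] into [E] is
    continuous because [D] is bounded ([disk_inclusion_continuous]).  It maps
    bounded sets into multiples of [D], and the seminorm of a functional over
    [D] is its seminorm over [A] ([dual_seminorm_hull_le]), so that it maps
    bounded sets to limited sets ([disk_inclusion_limited]).  If it maps
    bounded sets to totally bounded sets, then [D], the image of the unit ball,
    is totally bounded, and so is [A].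

    If [E] is locally complete then [disk_space D] is a Banach space
    ([disk_space_complete]).  A fast Cauchy sequence in [disk_space D] has
    increments [2^-n z_n] with [z_n] tending to 0, so that half of its partial
    sums stay in the compact hull of the sequence [z].  They have a cluster
    point in [E], and as the multiples of [D] are closed this point is the
    limit for the gauge norm.

    It remains to see that limited sets are bounded ([E_limited_bounded]).  If
    a continuous seminorm [rho] is unbounded on [A], choose [a_n] in [A] with
    [rho a_n > 2^(n+1)] and, by the Hahn-Banach theorem, functionals [g_n]
    bounded by [rho] with [|g_n(a_n)| >= rho a_n].  Then [2^-(n+1) g_n] is
    equicontinuous and weak* p-summable, but has modulus at least 1 at [a_n].
    The Hahn-Banach theorem is obtained from the fact that a minimal sublinear
    functional is linear ([hahn_banach_sublinear]), and for complex scalars by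
    complexification ([norming_functional]).

    Both notions of limited set enter only through three properties: limited
    sets are non-empty, they are bounded, and non-empty subsets of a multiple
    of the hull of a limited set are limited.  The equivalences are proved for
    any class of sets with these properties ([tfae_operators_precompact]). *)

Set Implicit Arguments.
Unset Strict Implicit.
Unset Printing Implicit Defensive.

Import Order.TTheory GRing.Theory Num.Theory.
Import numFieldNormedType.Exports.

Local Open Scope classical_set_scope.
Local Open Scope ring_scope.

(** * The reals inside the scalar field *)

(** The embedding of [R] into the scalars; norms with values in the scalar
    field, as normed modules have, are images under it of real gauges. *)
Definition scal (R : realType) (k : scalar_kind) : R -> scalars R k :=
  match k with
  | RealScalars => fun r => r
  | ComplexScalars => fun r => real_complex R r
  end.

Section Scal.
Context (R : realType) (k : scalar_kind).
Implicit Types (r s : R) (z : scalars R k).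

Fact scal_is_zmod_morphism : zmod_morphism (@scal R k).
Proof. by case: k => // x y; rewrite /scal rmorphB. Qed.

Fact scal_is_monoid_morphism : monoid_morphism (@scal R k).
Proof. by case: k => //=; split=> // x y; rewrite /= rmorphM. Qed.

HB.instance Definition _ :=
  GRing.isZmodMorphism.Build R (scalars R k) (@scal R k) scal_is_zmod_morphism.
HB.instance Definition _ :=
  GRing.isMonoidMorphism.Build R (scalars R k) (@scal R k)
    scal_is_monoid_morphism.

Lemma ler_scal r s : (scal k r <= scal k s) = (r <= s).
Proof. by case: k => //=; rewrite lecR. Qed.

Lemma scal_modulus z : scal k (modulus z) = `|z|.
Proof. by case: k z => //= z; rewrite normc_def. Qed.

Lemma ltr_scal r s : (scal k r < scal k s) = (r < s).
Proof. by rewrite !lt_neqAle ler_scal (inj_eq (fmorph_inj _)). Qed.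

Lemma scal_inj : injective (@scal R k). Proof. exact: fmorph_inj. Qed.

Lemma scal_ge0 r : (0 <= scal k r) = (0 <= r).
Proof. by rewrite -(rmorph0 (@scal R k)) ler_scal. Qed.

Lemma scal_gt0 r : (0 < scal k r) = (0 < r).
Proof. by rewrite -(rmorph0 (@scal R k)) ltr_scal. Qed.

Lemma modulus_ge0 z : 0 <= modulus z.
Proof. by rewrite -scal_ge0 scal_modulus. Qed.

Lemma modulusM z1 z2 : modulus (z1 * z2) = modulus z1 * modulus z2.
Proof. by apply: scal_inj; rewrite rmorphM /= !scal_modulus normrM. Qed.

Lemma modulus_scal r : modulus (scal k r) = `|r|.
Proof.
apply: scal_inj; rewrite scal_modulus; have [r0|/ltW r0] := leP 0 r.
  by rewrite ger0_norm ?scal_ge0 ?ger0_norm.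
by rewrite -normrN -rmorphN /= ger0_norm ?scal_ge0 ?oppr_ge0// ler0_norm.
Qed.

Lemma modulus_le r z : (modulus z <= r) = (`|z| <= scal k r).
Proof. by rewrite -scal_modulus ler_scal. Qed.

Lemma modulus_le1 z : (modulus z <= 1) = (`|z| <= 1).
Proof. by rewrite modulus_le rmorph1. Qed.

Lemma modulus0 : modulus (0 : scalars R k) = 0.
Proof. by rewrite -(rmorph0 (@scal R k)) modulus_scal normr0. Qed.

Lemma modulus_eq0 z : (modulus z == 0) = (z == 0).
Proof. by rewrite -(inj_eq scal_inj) scal_modulus rmorph0 normr_eq0. Qed.

Lemma modulus1 : modulus (1 : scalars R k) = 1.
Proof. by rewrite -(rmorph1 (@scal R k)) modulus_scal normr1. Qed.

Lemma modulus_gt0 z : (0 < modulus z) = (z != 0).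
Proof. by rewrite lt_neqAle eq_sym modulus_eq0 modulus_ge0 andbT. Qed.

Lemma modulusD z1 z2 : modulus (z1 + z2) <= modulus z1 + modulus z2.
Proof. by rewrite -ler_scal rmorphD /= !scal_modulus ler_normD. Qed.

End Scal.

(** * Disks and their gauges *)

(** Bundled, so that the gauge and the normed space below depend on the
    disk alone. *)
Record disk (R : realType) (k : scalar_kind) (V : lmodType (scalars R k)) :=
  Disk {
  disk_set :> V -> Prop;
  disk_nonempty : exists x, disk_set x;
  disk_absconvex : forall (x y : V) (a b : scalars R k),
    disk_set x -> disk_set y -> `|a| + `|b| <= 1 ->
    disk_set (a *: x + b *: y) }.

Section Gauge.
Context (R : realType) (k : scalar_kind) (V : lmodType (scalars R k)).
Context (D : disk V).
Implicit Types (x y : V) (r s t : R) (a : scalars R k).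

Definition absorbed x := exists2 t : R, 0 < t & D (scal k t^-1 *: x).

Definition gauge x : R := inf [set t : R | 0 < t /\ D (scal k t^-1 *: x)].

Lemma disk_balanced a x : `|a| <= 1 -> D x -> D (a *: x).
Proof.
move=> a1 Dx; rewrite -[_ *: _]addr0 -[X in _ + X](scale0r x).
by apply: disk_absconvex; rewrite ?normr0 ?addr0.
Qed.

Lemma disk0 : D 0.
Proof.
have [x Dx] := disk_nonempty D.
by rewrite -(scale0r x); apply: disk_balanced; rewrite ?normr0.
Qed.

Lemma disk_scale_le s t x : 0 < s -> s <= t ->
  D (scal k s^-1 *: x) -> D (scal k t^-1 *: x).
Proof.
move=> s0 st Dx; have t0 := lt_le_trans s0 st.
have -> : scal k t^-1 *: x = scal k (s / t) *: (scal k s^-1 *: x).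
  by rewrite scalerA -rmorphM /= mulrAC divff ?gt_eqF// mul1r.
apply: disk_balanced => //.
rewrite -modulus_le1 modulus_scal ger0_norm.
  by rewrite ler_pdivrMr ?mul1r.
by rewrite divr_ge0// ltW.
Qed.

Lemma gauge_ge0 x : 0 <= gauge x.
Proof.
rewrite /gauge; set S := (X in inf X).
have [->|/set0P S0] := eqVneq S set0; first by rewrite inf0.
by apply: lb_le_inf => // t [/ltW].
Qed.

Lemma gauge_le t x : 0 < t -> D (scal k t^-1 *: x) -> gauge x <= t.
Proof. by move=> t0 Dx; apply: ge_inf => //; exists 0 => s [/ltW]. Qed.

(** The condition [absorbed x] excludes the infimum of the empty set, whose
    value is 0 by convention. *)
Lemma gauge_lt x t : absorbed x -> gauge x < t -> D (scal k t^-1 *: x).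
Proof.
move=> [u u0 Du] xt.
have [||s [s0 Ds] st] := @inf_adherent _
    [set t : R | 0 < t /\ D (scal k t^-1 *: x)] (t - gauge x).
- by rewrite subr_gt0.
- by split; [exists u | exists 0 => s [/ltW]].
by apply: disk_scale_le Ds => //; rewrite ltW // (lt_le_trans st)// addrC subrK.
Qed.

Lemma gauge_le1 x : D x -> gauge x <= 1.
Proof. by move=> Dx; apply: gauge_le => //; rewrite invr1 rmorph1 scale1r. Qed.

Lemma gauge_lt1 x : absorbed x -> gauge x < 1 -> D x.
Proof.
by move=> ax /(gauge_lt ax); rewrite invr1 rmorph1 scale1r.
Qed.

Lemma absorbed0 : absorbed 0.
Proof. by exists 1 => //; rewrite scaler0; exact: disk0. Qed.

(** [(x + y) / (s + t)] is the convex combination of [x / s] and [y / t] with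
    weights [s / (s + t)] and [t / (s + t)]. *)
Lemma disk_scaleD x y s t : 0 < s -> 0 < t ->
  D (scal k s^-1 *: x) -> D (scal k t^-1 *: y) ->
  D (scal k (s + t)^-1 *: (x + y)).
Proof.
move=> s0 t0 Dx Dy; have st0 := addr_gt0 s0 t0.
have -> : scal k (s + t)^-1 *: (x + y) =
    scal k (s / (s + t)) *: (scal k s^-1 *: x) +
    scal k (t / (s + t)) *: (scal k t^-1 *: y).
  rewrite !scalerA -!rmorphM /= scalerDr.
  by congr (scal k _ *: _ + scal k _ *: _); field; rewrite !gt_eqF.
apply: disk_absconvex => //.
rewrite -!scal_modulus -rmorphD -(rmorph1 (@scal R k)) ler_scal !modulus_scal.
rewrite !ger0_norm; first by rewrite -mulrDl divff ?gt_eqF.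
  by rewrite divr_ge0 ?ltW.
by rewrite divr_ge0 ?ltW.
Qed.

Lemma absorbedD x y : absorbed x -> absorbed y -> absorbed (x + y).
Proof.
move=> [s s0 Dx] [t t0 Dy]; exists (s + t); first exact: addr_gt0.
exact: disk_scaleD.
Qed.

Lemma gaugeD x y : absorbed x -> absorbed y ->
  gauge (x + y) <= gauge x + gauge y.
Proof.
move=> ax ay; apply/ler_addgt0Pr => e e0.
have gl z : absorbed z -> D (scal k (gauge z + e / 2)^-1 *: z).
  by move=> az; apply: gauge_lt => //; rewrite ltrDl divr_gt0.
have g0 z : 0 < gauge z + e / 2 by rewrite ltr_wpDl ?gauge_ge0 ?divr_gt0.
have -> : gauge x + gauge y + e = (gauge x + e / 2) + (gauge y + e / 2).
  by field.
by apply: gauge_le; [exact: addr_gt0|exact: disk_scaleD (gl _ _) (gl _ _)].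
Qed.

Lemma disk_scaleZ a x t : a != 0 -> D (scal k t^-1 *: x) ->
  D (scal k (modulus a * t)^-1 *: (a *: x)).
Proof.
move=> a0 Dx; rewrite invfM rmorphM /= scalerA -mulrAC -scalerA.
apply: disk_balanced => //.
by rewrite -modulus_le1 modulusM modulus_scal ger0_norm ?invr_ge0 ?modulus_ge0//
  mulVf ?modulus_eq0.
Qed.

Lemma absorbedZ a x : absorbed x -> absorbed (a *: x).
Proof.
have [->|a0] := eqVneq a 0.
  by move=> _; rewrite scale0r; exact: absorbed0.
move=> [t t0 Dx]; exists (modulus a * t); last exact: disk_scaleZ.
by rewrite mulr_gt0// modulus_gt0.
Qed.

Lemma gauge0 : gauge 0 = 0.
Proof.
apply/eqP; rewrite eq_le gauge_ge0 andbT; apply/ler_addgt0Pr => e e0.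
by rewrite add0r; apply: gauge_le => //; rewrite scaler0; exact: disk0.
Qed.

Lemma gaugeZ a x : absorbed x -> gauge (a *: x) = modulus a * gauge x.
Proof.
have gZ b y : b != 0 -> absorbed y -> gauge (b *: y) <= modulus b * gauge y.
  move=> b0 ay; have m0 : 0 < modulus b.
    by rewrite modulus_gt0.
  rewrite mulrC -ler_pdivrMr//; apply/ler_addgt0Pr => e e0.
  rewrite ler_pdivrMr// mulrC.
  have e1 : 0 < gauge y + e by rewrite ltr_wpDl ?gauge_ge0.
  apply: gauge_le; first exact: mulr_gt0.
  by apply: disk_scaleZ => //; apply: gauge_lt => //; rewrite ltrDl.
have [->|a0 ax] := eqVneq a 0.
  by move=> _; rewrite scale0r gauge0 modulus0 mul0r.
apply/eqP; rewrite eq_le gZ//=.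
have m0 : 0 < modulus a.
  by rewrite modulus_gt0.
have := gZ a^-1 (a *: x); rewrite invr_eq0 => /(_ a0 (absorbedZ _ ax)).
rewrite scalerA mulVf// scale1r -(ler_pM2l m0) mulrA -modulusM mulfV//.
by rewrite modulus1 mul1r.
Qed.

End Gauge.

(** * Sublinear functionals and the Hahn-Banach theorem *)

Section Sublinear.
Context (R : realType) (k : scalar_kind) (V : lmodType (scalars R k)).
Implicit Types (q : V -> R) (x y : V) (r s : R).

(** One inequality suffices for positive homogeneity: applied to the inverse
    scalar it gives the other one ([sublinearZ]). *)
Definition sublinear q : Prop :=
  (forall x y, q (x + y) <= q x + q y) /\
  (forall r x, 0 < r -> q (scal k r *: x) <= r * q x).

Lemma sublinear0 q : sublinear q -> q 0 = 0.
Proof.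
move=> [qD qZ]; apply/eqP; rewrite eq_le; apply/andP; split.
  by have := qZ (1 / 2) 0 ltac:(lra); rewrite scaler0; lra.
by have := qD 0 0; rewrite addr0; lra.
Qed.

Lemma sublinearZ q r x : sublinear q -> 0 <= r -> q (scal k r *: x) = r * q x.
Proof.
move=> qS; have [_ qZ] := qS; rewrite le_eqVlt => /predU1P[<-|r0].
  by rewrite rmorph0 scale0r mul0r sublinear0.
apply/eqP; rewrite eq_le qZ//=.
have := qZ r^-1 (scal k r *: x); rewrite invr_gt0 => /(_ r0).
rewrite scalerA -rmorphM /= mulVf ?gt_eqF// rmorph1 scale1r.
by rewrite mulrC ler_pdivlMr// mulrC.
Qed.

Lemma sublinear_opp q x : sublinear q -> - q (- x) <= q x.
Proof.
move=> qS; have [qD _] := qS.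
by have := qD x (- x); rewrite subrr sublinear0//; lra.
Qed.

Lemma le_infD (S T : set R) m : has_inf S -> has_inf T ->
  (forall s t, S s -> T t -> m <= s + t) -> m <= inf S + inf T.
Proof.
move=> Si Ti mST; rewrite -lerBlDl; apply: lb_le_inf; first exact: Ti.1.
move=> t Tt; rewrite lerBlDl -lerBlDr.
by apply: lb_le_inf; [exact: Si.1|move=> s Ss; rewrite lerBlDr mST].
Qed.

(** The infimum of [slack q x y] over the parameter is, as a function of [y],
    the largest sublinear minorant of [q] that takes the value [- q x] at
    [- x]: it is the tool for showing that a minimal [q] is odd. *)
Definition slack q x y :=
  [set q (y + scal k r *: x) - r * q x | r in [set r | 0 <= r]].

Lemma slack_has_inf q x y : sublinear q -> has_inf (slack q x y).
Proof.
move=> qS; have [qD _] := qS; split.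
  by exists (q (y + scal k 0 *: x) - 0 * q x); exists 0 => //=; exact: lexx.
exists (- q (- y)) => _ [r /= r0 <-].
have := qD (y + scal k r *: x) (- y).
by rewrite addrAC subrr add0r sublinearZ//; lra.
Qed.

Lemma slack_inf_sublinear q x : sublinear q ->
  sublinear (fun y => inf (slack q x y)).
Proof.
move=> qS; have [qD _] := qS; split=> [y z|a y a0].
  apply: le_infD; [exact: slack_has_inf|exact: slack_has_inf|].
  move=> _ _ [r /= r0 <-] [s /= s0 <-]; apply: (@le_trans _ _
    (q (y + z + scal k (r + s) *: x) - (r + s) * q x)).
    apply: ge_inf; first exact: (slack_has_inf _ _ qS).2.
    by exists (r + s) => //=; rewrite addr_ge0.
  rewrite rmorphD /= scalerDl addrACA.
  by have := qD (y + scal k r *: x) (z + scal k s *: x); lra.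
rewrite mulrC -ler_pdivrMr//.
apply: lb_le_inf; first exact: (slack_has_inf _ _ qS).1.
move=> _ [r /= r0 <-]; rewrite ler_pdivrMr//.
have -> : (q (y + scal k r *: x) - r * q x) * a =
   q (scal k a *: y + scal k (a * r) *: x) - (a * r) * q x.
  by rewrite rmorphM /= -scalerA -scalerDr sublinearZ ?ltW//; ring.
apply: ge_inf; first exact: (slack_has_inf _ _ qS).2.
by exists (a * r) => //=; rewrite mulr_ge0// ltW.
Qed.

Lemma slack_inf_le q x y : sublinear q -> inf (slack q x y) <= q y.
Proof.
move=> qS; apply: ge_inf; first exact: (slack_has_inf _ _ qS).2.
by exists 0 => //=; rewrite rmorph0 scale0r addr0 mul0r subr0.
Qed.

Lemma slack_inf_opp q x : sublinear q -> inf (slack q x (- x)) <= - q x.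
Proof.
move=> qS; apply: ge_inf; first exact: (slack_has_inf _ _ qS).2.
exists 1 => //=; rewrite ?ler01// rmorph1 scale1r addNr sublinear0// mul1r.
by rewrite add0r.
Qed.

(** Zorn's lemma: the pointwise infimum of a chain of sublinear minorants of
    [p] is finite since [- p (- x)] is a lower bound at [x], and it is
    subadditive since any two members of the chain are comparable. *)
Lemma minimal_sublinear p : sublinear p -> exists q, [/\ sublinear q,
  forall x, q x <= p x &
  forall q', sublinear q' -> (forall x, q' x <= q x) -> q' = q].
Proof.
move=> pS; pose T := {q : V -> R | sublinear q /\ forall x, q x <= p x}.
pose le_ (q1 q2 : T) := `[< forall x, sval q2 x <= sval q1 x >].
have [|||A Atot|t tmax] := @Zorn T le_.
- by move=> q; apply/asboolP.
- move=> q1 q2 q3 /asboolP q12 /asboolP q23; apply/asboolP => x.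
  exact: le_trans (q23 x) (q12 x).
- move=> [q1 q1P] [q2 q2P] /asboolP/= q12 /asboolP/= q21.
  apply: eq_exist; apply/funext => x.
  by apply/eqP; rewrite eq_le q12 q21.
- have [->|/set0P[q0 Aq0]] := eqVneq A set0.
    by exists (exist _ p (conj pS (fun=> lexx _))).
  pose S x := [set sval q x | q in A].
  have Si x : has_inf (S x).
    split; first by exists (sval q0 x), q0.
    exists (- p (- x)) => _ [q _ <-].
    rewrite (le_trans _ (sublinear_opp _ (svalP q).1))// lerN2.
    exact: (svalP q).2.
  have iS : sublinear (fun x => inf (S x)).
    split=> [x y|r x r0].
      apply: le_infD => // _ _ [q1 Aq1 <-] [q2 Aq2 <-].
      have [/asboolP q12|/asboolP q21] := Atot _ _ Aq1 Aq2.
        apply: (@le_trans _ _ (sval q2 (x + y))).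
          by apply: ge_inf; [exact: (Si _).2|exists q2].
        rewrite (le_trans ((svalP q2).1.1 x y))//.
        by rewrite lerD2r.
      apply: (@le_trans _ _ (sval q1 (x + y))).
        by apply: ge_inf; [exact: (Si _).2|exists q1].
      by rewrite (le_trans ((svalP q1).1.1 x y))// lerD2l.
    rewrite mulrC -ler_pdivrMr//; apply: lb_le_inf; first exact: (Si x).1.
    move=> _ [q Aq <-]; rewrite ler_pdivrMr// mulrC.
    rewrite -(sublinearZ _ (svalP q).1 (ltW r0)).
    by apply: ge_inf; [exact: (Si _).2|exists q].
  have ip x : inf (S x) <= p x.
    apply: (@le_trans _ _ (sval q0 x)); last exact: (svalP q0).2.
    by apply: ge_inf; [exact: (Si _).2|exists q0].
  exists (exist _ (fun x => inf (S x)) (conj iS ip)) => q Aq.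
  apply/asboolP => x /=.
  by apply: ge_inf; [exact: (Si _).2|exists q].
exists (sval t); split; [exact: (svalP t).1|exact: (svalP t).2|].
move=> q' q'S q't; have q'p x : q' x <= p x.
  exact: le_trans (q't x) ((svalP t).2 x).
pose s : T := exist _ q' (conj q'S q'p).
suff <- : s = t by [].
by apply: tmax; apply/asboolP.
Qed.

(** A minimal sublinear [f] is linear: the infimum of [slack f x] is a
    sublinear minorant of [f], hence equals [f], and so [f (- x) <= - f x]; an
    odd sublinear functional is additive.  Minimising below the infimum of
    [slack p x0] instead of below [p] forces [f x0 = p x0]. *)
Lemma hahn_banach_sublinear p x0 : sublinear p -> exists f : V -> R, [/\
  forall x y, f (x + y) = f x + f y,
  forall r x, f (scal k r *: x) = r * f x,
  forall x, f x <= p x &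
  f x0 = p x0].
Proof.
move=> pS.
have [f [fS fp fmin]] := minimal_sublinear (slack_inf_sublinear x0 pS).
have fN x : f (- x) = - f x.
  apply/eqP; rewrite eq_le; apply/andP; split.
    rewrite -[in X in X <= _](fmin _ (slack_inf_sublinear x fS)).
      exact: slack_inf_opp.
    by move=> y; exact: slack_inf_le.
  by rewrite lerNl; exact: sublinear_opp.
have fp' x : f x <= p x by rewrite (le_trans (fp x))// slack_inf_le.
have fZ r x : 0 <= r -> f (scal k r *: x) = r * f x by exact: sublinearZ.
exists f; split=> //.
- move=> x y; apply/eqP; rewrite eq_le fS.1/=.
  by have := fS.1 (- x) (- y); rewrite -opprD !fN; lra.
- move=> r x; have [/fZ //|/ltW r0] := leP 0 r.
  by rewrite -[r]opprK rmorphN scaleNr fN fZ ?oppr_ge0//; ring.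
- apply/eqP; rewrite eq_le fp'/= -lerN2 -fN.
  by rewrite (le_trans (fp _))// slack_inf_opp.
Qed.

End Sublinear.

Definition seminorm (R : realType) (k : scalar_kind)
    (V : lmodType (scalars R k)) (rho : V -> R) : Prop :=
  (forall x y, rho (x + y) <= rho x + rho y) /\
  (forall a x, rho (a *: x) = modulus a * rho x).

Section Seminorm.
Context (R : realType) (k : scalar_kind) (V : lmodType (scalars R k)).
Context (rho : V -> R) (rhoS : seminorm rho).

Lemma seminorm0 : rho 0 = 0.
Proof. by rewrite -(scale0r (0 : V)) rhoS.2 modulus0 mul0r. Qed.

Lemma seminormN x : rho (- x) = rho x.
Proof.
by rewrite -scaleN1r -(rmorph1 (@scal R k)) -rmorphN rhoS.2 modulus_scal
  normrN1 mul1r.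
Qed.

Lemma seminorm_ge0 x : 0 <= rho x.
Proof. by have := rhoS.1 x (- x); rewrite subrr seminorm0 seminormN; lra. Qed.

End Seminorm.

Section Norming.
Context (R : realType).

Lemma seminorm_sublinear (k : scalar_kind) (V : lmodType (scalars R k))
    (rho : V -> R) :
  seminorm rho -> sublinear rho.
Proof.
by move=> [rD rZ]; split=> // r x r0; rewrite rZ modulus_scal gtr0_norm.
Qed.

(** Complex linearity forces the imaginary part of [g x] to be minus the real
    part of [g (i x)], so [f] determines [g]. *)
Lemma complexify (V : lmodType (scalars R ComplexScalars)) (f : V -> R) :
  (forall x y, f (x + y) = f x + f y) ->
  (forall r x, f (scal ComplexScalars r *: x) = r * f x) ->
  exists g : {linear V -> (scalars R ComplexScalars)^o},
    forall x, complex.Re (g x) = f x.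
Proof.
move=> fD fZ.
pose g (x : V) : (scalars R ComplexScalars)^o := (f x +i* - f ('i%C *: x))%C.
have glin : linear g.
  move=> [u v] x y.
  have E (z : V) : (u +i* v)%C *: z =
      scal ComplexScalars u *: z + scal ComplexScalars v *: ('i%C *: z).
    rewrite scalerA -scalerDl; congr (_ *: _).
    by rewrite /scal /real_complex_def; simpc.
  have ii (z : V) : 'i%C *: ('i%C *: z) = - z.
    by rewrite scalerA -expr2 sqr_i scaleN1r.
  have fN z : f (- z) = - f z.
    by rewrite -scaleN1r -(rmorph1 (@scal R ComplexScalars)) -rmorphN fZ mulN1r.
  have -> : g (((u +i* v)%C : scalars R ComplexScalars) *: x + y) =
      ((u * f x + v * f ('i%C *: x) + f y) +i*
       - (u * f ('i%C *: x) - v * f x + f ('i%C *: y)))%C.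
    rewrite /g scalerDr fD (fD _ ('i%C *: y)).
    have -> : 'i%C *: ((u +i* v)%C *: x) = (u +i* v)%C *: ('i%C *: x).
      by rewrite !scalerA mulrC.
    by rewrite !E !fD !fZ ii fN mulrN.
  apply/eqP; rewrite eq_complex /g /=; apply/andP; split; apply/eqP; ring.
pose G : {linear V -> (scalars R ComplexScalars)^o} :=
  HB.pack g (GRing.isLinear.Build _ _ _ _ g glin).
by exists G.
Qed.

(** In the complex case, rotating [x] by the phase [c] that makes [g (c x)]
    equal to the modulus of [g x] turns the bound on the real part of [g] into
    a bound on its modulus. *)
Lemma norming_functional (k : scalar_kind) (V : lmodType (scalars R k))
    (rho : V -> R) (x0 : V) :
  seminorm rho -> exists g : {linear V -> (scalars R k)^o},
    (forall x, modulus (g x) <= rho x) /\ rho x0 <= modulus (g x0).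
Proof.
case: k V rho x0 => V rho x0 rS;
  have [f [fD fZ fr f0]] := hahn_banach_sublinear x0 (seminorm_sublinear rS).
  have flin : linear (f : V -> (scalars R RealScalars)^o).
    by move=> a x y; rewrite fD (fZ a).
  pose F : {linear V -> (scalars R RealScalars)^o} :=
    HB.pack (f : V -> (scalars R RealScalars)^o)
      (GRing.isLinear.Build _ _ _ _ _ flin).
  exists F.
  rewrite /=; split; last by rewrite -f0 ler_norm.
  move=> x; rewrite ler_norml fr andbT lerNl.
  have := fr (scal RealScalars (-1) *: x).
  by rewrite fZ rS.2 modulus_scal normrN1 mulN1r mul1r.
have [g gf] := complexify fD fZ; exists g; split; last first.
  rewrite -f0 -gf /modulus.
  have := normc_ge_Re (g x0); rewrite lecE /= => /andP[_].
  by apply: le_trans; rewrite ler_norm.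
move=> x; have [gx0|gx0] := eqVneq (g x) 0.
  by rewrite gx0 modulus0 seminorm_ge0.
pose c : scalars R ComplexScalars := `|g x| / g x.
have c1 : modulus c = 1.
  by rewrite /c modulusM -scal_modulus modulus_scal ger0_norm ?modulus_ge0//
    -modulusM mulfV// -(rmorph1 (@scal R ComplexScalars)) modulus_scal normr1.
have := fr (c *: x); rewrite rS.2 c1 mul1r -gf linearZ /=.
by rewrite /c /GRing.scale /= mulfVK.
Qed.

End Norming.

(** * Summability of sequences *)

Section SequenceSpaces.
Context (R : realType).
Implicit Types (q : \bar R) (u v : nat -> \bar R).
Local Open Scope ereal_scope.

Lemma lp_finite (r : R) u : (1 <= r)%R -> (forall n, 0 <= u n) ->
  lp_or_c0 r%:E u <-> \sum_(n <oo) (u n `^ r) < +oo.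
Proof.
move=> r1 u0; have r0 : (0 < r)%R by rewrite (lt_le_trans _ r1).
rewrite /lp_or_c0 Lnorm_counting//.
under eq_eseriesr do rewrite gee0_abs//.
by split=> [/lty_poweRy|]; [apply; rewrite invr_neq0 ?gt_eqF|exact: poweR_lty].
Qed.

Lemma lp_or_c0_le q (c : R) u v : 1 <= q -> (0 <= c)%R ->
  (forall n, 0 <= u n) -> (forall n, 0 <= v n) ->
  (forall n, u n <= c%:E * v n) -> lp_or_c0 q v -> lp_or_c0 q u.
Proof.
move=> + c0 u0 v0 uv; case: q => [r r1||//].
  rewrite lee_fin in r1; have r0 : (0 <= r)%R by rewrite (le_trans _ r1).
  move=> /(lp_finite r1 v0) vr; apply/(lp_finite r1 u0).
  apply: (@le_lt_trans _ _ (\sum_(n <oo) ((c `^ r)%:E * v n `^ r))).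
    apply: lee_nneseries => [n _ _|n _]; first exact: poweR_ge0.
    rewrite -poweR_EFin -poweRM//.
    by apply: gt0_ler_poweR => //; rewrite in_itv/= ?leey ?andbT ?mule_ge0.
  rewrite nneseriesZl; last by move=> *; exact: poweR_ge0.
  by rewrite lte_mul_pinfty ?lee_fin ?powR_ge0.
move=> _ /= v_cvg; apply: (squeeze_cvge _ (cvg_cst 0)); last first.
  by rewrite -(mule0 c%:E); apply: cvgeZl v_cvg.
by apply: nearW => n; rewrite u0 uv.
Qed.

(** [2^-(n+1)], in the form used by the sum of the geometric series. *)
Definition half_weight n : R := (1 / (2 ^ (n + 1))%:R)%R.

Lemma half_weight_itv n : (0 < half_weight n <= 1)%R.
Proof.
rewrite /half_weight divr_gt0 ?ltr0n ?expn_gt0//=.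
by rewrite ler_pdivrMr ?ltr0n ?expn_gt0// mul1r ler1n expn_gt0.
Qed.

Lemma half_weight_summable q : 1 <= q ->
  lp_or_c0 q (fun n => (half_weight n)%:E).
Proof.
have w0 n : 0 <= (half_weight n)%:E.
  by rewrite lee_fin ltW//; have /andP[] := half_weight_itv n.
have ws : \sum_(n <oo) (half_weight n)%:E = (1 / 2 ^+ 0)%:E.
  by apply: cvg_lim => //; exact: (@cvg_geometric_eseries_half R 1%R 0%N).
case: q => [r r1||//].
  rewrite lee_fin in r1; apply/(lp_finite r1 w0).
  apply: (@le_lt_trans _ _ (\sum_(n <oo) (half_weight n)%:E)).
    apply: lee_nneseries => [n _ _|n _]; first exact: poweR_ge0.
    by rewrite poweR_EFin lee_fin ge1r_powR// half_weight_itv.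
  by rewrite ws ltry.
move=> _ /=; apply: cvg_EFin; first exact: nearW.
apply: (@cvg_series_cvg_0 _ R^o).
by apply: cvgP; exact: (@cvg_geometric_series_half R 1%R 0%N).
Qed.

Lemma not_lp_or_c0 q u : 1 <= q -> (forall n, 1 <= u n) -> ~ lp_or_c0 q u.
Proof.
move=> + u1; have u0 n : 0 <= u n by rewrite (le_trans _ (u1 n)).
case: q => [r r1||//].
  rewrite lee_fin in r1; have r0 : (0 <= r)%R by rewrite (le_trans _ r1).
  move=> /(lp_finite r1 u0).
  set S := \sum_(n <oo) _ => S_oo.
  have nS n : n%:R%:E <= S.
    apply: le_trans (nneseries_lim_ge n _); last by move=> *; exact: poweR_ge0.
    have -> : n%:R%:E = \sum_(0 <= i < n) (1%:E : \bar R).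
      by rewrite sumEFin sumr_const_nat subn0.
    apply: lee_sum => i _; rewrite -(poweR1r r).
    by apply: gt0_ler_poweR => //; rewrite in_itv/= ?leey ?andbT.
  have S0 : 0 <= S by exact: le_trans (nS 0%N).
  have Sf : S \is a fin_num by rewrite ge0_fin_numE.
  have := nS (Num.truncn (fine S)).+1.
  rewrite -(fineK Sf) lee_fin leNgt => /negP; apply.
  exact: truncnS_gt.
move=> _ /= ucvg; suff : (1%:E : \bar R) <= 0 by rewrite lee_fin ler10.
by rewrite -(cvg_lim _ ucvg)//; apply: lime_ge; [exact: cvgP ucvg|exact: nearW].
Qed.

End SequenceSpaces.

(** * The normed space spanned by a disk *)

Record linefree_disk (R : realType) (k : scalar_kind)
    (V : lmodType (scalars R k)) := LinefreeDisk {
  linefree_disk_disk :> disk V;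
  disk_linefree : forall x,
    (forall t : R, 0 < t -> linefree_disk_disk (scal k t^-1 *: x)) -> x = 0 }.

Section DiskSpace.
Context (R : realType) (k : scalar_kind) (V : lmodType (scalars R k)).
Context (D : linefree_disk V).

Definition disk_span : {pred V} := fun x => `[< absorbed D x >].

Lemma disk_spanP x : reflect (absorbed D x) (x \in disk_span).
Proof. exact: asboolP. Qed.

Fact disk_span_submod : GRing.subsemimod_closed disk_span.
Proof.
split; first split.
- by apply/disk_spanP; exact: absorbed0.
- move=> x y /disk_spanP xD /disk_spanP yD; apply/disk_spanP.
  exact: absorbedD.
- by move=> a x /disk_spanP xD; apply/disk_spanP; exact: absorbedZ.
Qed.

HB.instance Definition _ :=
  GRing.isSubmodClosed.Build _ V disk_span disk_span_submod.

Definition disk_space := {x : V | x \in disk_span}.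

HB.instance Definition _ := SubType.on disk_space.
HB.instance Definition _ := [Choice of disk_space by <:].
HB.instance Definition _ := [SubChoice_isSubLmodule of disk_space by <:].

Implicit Types x y : disk_space.

Lemma disk_space_absorbed x : absorbed D (val x).
Proof. by apply/disk_spanP; exact: valP. Qed.

Definition disk_norm x : scalars R k := scal k (gauge D (val x)).

Fact disk_normD x y : disk_norm (x + y) <= disk_norm x + disk_norm y.
Proof.
rewrite /disk_norm -rmorphD ler_scal raddfD.
apply: gaugeD; exact: disk_space_absorbed.
Qed.

Fact disk_normZ (a : scalars R k) x : disk_norm (a *: x) = `|a| * disk_norm x.
Proof.
rewrite /disk_norm linearZ /= gaugeZ ?rmorphM /= ?scal_modulus//.
exact: disk_space_absorbed.
Qed.

Fact disk_norm_eq0 x : disk_norm x = 0 -> x = 0.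
Proof.
move=> x0; apply: val_inj; rewrite raddf0; apply: disk_linefree => t t0.
apply: gauge_lt; first exact: disk_space_absorbed.
suff -> : gauge D (val x) = 0 by [].
by apply: (@scal_inj R k); rewrite rmorph0.
Qed.

HB.instance Definition _ := Lmodule_isNormed.Build _ disk_space
  disk_normD disk_normZ disk_norm_eq0.

Lemma disk_space_normE x : `|x| = scal k (gauge D (val x)).
Proof. by []. Qed.

End DiskSpace.

(** * Continuous seminorms on a locally convex space *)

Section TvsSeminorms.
Context (R : realType) (k : scalar_kind) (E : tvsType (scalars R k)).
Local Notation K := (scalars R k).
Implicit Types (A B U : set E) (rho : E -> R) (x y : E).

(** Continuity at 0, which for a seminorm amounts to continuity. *)
Definition continuous_seminorm rho : Prop :=
  seminorm rho /\ nbhs (0 : E) [set x | rho x < 1].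

Lemma ball0_scal (W : set K^o) : nbhs (0 : K^o) W ->
  exists2 r : R, 0 < r & forall a : K, modulus a <= r -> W a.
Proof.
move=> /nbhs_ballP [e /= e0 eW]; exists (modulus e / 2).
  by rewrite divr_gt0// modulus_gt0 gt_eqF.
move=> a ar; apply: eW; rewrite -ball_normE /= sub0r normrN.
rewrite -scal_modulus -(gtr0_norm e0) -scal_modulus ltr_scal (le_lt_trans ar)//.
rewrite ltr_pdivrMr// ltr_pMr ?ltr1n//.
by rewrite modulus_gt0 gt_eqF.
Qed.

Lemma nbhs_shift x U : nbhs x U -> nbhs (0 : E) [set u | U (x + u)].
Proof.
move=> /(nbhsB (- x)); rewrite addNr; apply: filterS => _ [y Uy <-] /=.
by rewrite addrA addrN add0r.
Qed.

Lemma convex_subcombination (C : set E) (x y : E) (s t : R) :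
  convex_set C -> C 0 -> C x -> C y -> 0 <= s -> 0 <= t -> s + t <= 1 ->
  C (scal k s *: x + scal k t *: y).
Proof.
move=> Cconv C0 Cx Cy s0 t0 st1.
have seg (u : R) (v w : E) : 0 <= u -> u <= 1 -> C v -> C w ->
    C (scal k u *: v + scal k (1 - u) *: w).
  move=> u0 u1 Cv Cw.
  have h0 : 0 <= scal k u by rewrite scal_ge0.
  have h1 : scal k u <= 1 by rewrite -(rmorph1 (@scal R k)) ler_scal.
  have := Cconv v w (Itv01 h0 h1); rewrite !inE => /(_ Cv Cw).
  by rewrite rmorphB rmorph1.
have [st0|st0] := eqVneq (s + t) 0.
  have -> : s = 0 by lra.
  have -> : t = 0 by lra.
  by rewrite !rmorph0 !scale0r addr0.
have stp : 0 < s + t by rewrite lt_neqAle eq_sym st0 addr_ge0.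
have sst : s / (s + t) <= 1 by rewrite ler_pdivrMr// mul1r lerDl.
have := seg (s + t) _ 0 (ltW stp) st1 (seg (s / (s + t)) x y _ sst Cx Cy) C0.
rewrite divr_ge0 ?(ltW stp)// => /(_ isT).
rewrite scaler0 addr0 scalerDr !scalerA -!rmorphM /=.
have -> : (s + t) * (s / (s + t)) = s by field.
by have -> : (s + t) * (1 - s / (s + t)) = t by field.
Qed.

(** In a convex neighbourhood [C] of 0, the points all of whose multiples by
    scalars of norm at most 1 lie in [C] form a disk, and it is a neighbourhood
    of 0 by continuity of the scalar multiplication. *)
Lemma ex_disk_nbhs U : nbhs (0 : E) U ->
  exists D : disk E, [/\ forall x, D x -> U x, nbhs (0 : E) D &
    forall x, absorbed D x].
Proof.
move=> U0; have [B Bconv [Bopen Bbasis]] := @locally_convex K E.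
have [C [BC C0] CU] := Bbasis 0 U U0.
have C0nbhs : nbhs (0 : E) C by apply: open_nbhs_nbhs; split=> //; exact: Bopen.
pose V := [set x : E | forall a : K, `|a| <= 1 -> C (a *: x)].
have Vabsconvex (x y : E) (a b : K) :
    V x -> V y -> `|a| + `|b| <= 1 -> V (a *: x + b *: y).
  move=> Vx Vy ab c c1.
  (* the phases of [c * a] and [c * b] are moved into the points, which leaves
     a combination with nonnegative real coefficients of sum at most 1 *)
  have polar (d : K) (z : E) : V z ->
      exists2 w, C w & d *: z = scal k (modulus d) *: w.
    move=> Vz; exists ((d / scal k (modulus d)) *: z).
      apply: Vz; rewrite -modulus_le1 modulusM -fmorphV modulus_scal.
      rewrite ger0_norm ?invr_ge0 ?modulus_ge0//.
      have [->|d0] := eqVneq (modulus d) 0; first by rewrite mul0r.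
      by rewrite mulfV.
    rewrite scalerA mulrCA; have [->|d0] := eqVneq d 0; first by rewrite mul0r.
    by rewrite mulfV ?mulr1// scal_modulus normr_eq0.
  have [x' Cx' xx'] := polar (c * a) x Vx.
  have [y' Cy' yy'] := polar (c * b) y Vy.
  rewrite scalerDr !scalerA xx' yy'; apply: convex_subcombination => //;
    rewrite ?modulus_ge0//; first by apply: Bconv; rewrite inE.
  rewrite !modulusM -mulrDr mulr_ile1 ?addr_ge0 ?modulus_ge0//.
    by rewrite modulus_le1.
  by rewrite -(ler_scal k) rmorphD rmorph1 /= !scal_modulus.
have [[W1 W2] /= [W10 W20] W12] := @scale_continuous K E (0, 0) C
   ltac:(rewrite /= scaler0; exact: C0nbhs).
have [r r0 rW1] := ball0_scal W10.
have V0 : nbhs (0 : E) V.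
  have /nbhs0Z : scal k r != 0 by rewrite gt_eqF// scal_gt0.
  move=> /(_ _ _ W20); apply: filterS => _ [w W2w <-] a a1.
  rewrite scalerA; apply: (W12 (_, _)); split=> //=; apply: rW1.
  by rewrite modulusM modulus_scal gtr0_norm// ler_piMl ?modulus_le1// (ltW r0).
exists (Disk (ex_intro _ 0 (nbhs_singleton V0)) Vabsconvex); split=> //.
  by move=> x /(_ 1); rewrite normr1 scale1r => /(_ (lexx _))/CU.
move=> x.
have [[X1 X2] /= [X10 X20] X12] := @scale_continuous K E (0, x) V
   ltac:(rewrite /= scale0r; exact: V0).
have [s s0 sX1] := ball0_scal X10.
exists s^-1; rewrite ?invr_gt0// invrK.
apply: (X12 (_, _)); split => /=; last exact: nbhs_singleton.
by apply: sX1; rewrite modulus_scal gtr0_norm.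
Qed.

Lemma ex_continuous_seminorm U : nbhs (0 : E) U ->
  exists2 rho, continuous_seminorm rho & forall x, rho x < 1 -> U x.
Proof.
move=> /ex_disk_nbhs [D [DU D0 Dabs]]; exists (gauge D).
  split; first by split=> *; [exact: gaugeD|exact: gaugeZ].
  have /nbhs0Z : scal k (1 / 2) != 0 :> K.
    by rewrite gt_eqF// scal_gt0.
  move=> /(_ _ _ D0); apply: filterS => _ [w Dw <-] /=.
  rewrite gaugeZ// modulus_scal gtr0_norm//.
  by have := gauge_le1 Dw; lra.
by move=> x /gauge_lt1 xD; apply: DU; exact: xD.
Qed.

Lemma continuous_seminorm_nbhs rho x (e : R) :
  continuous_seminorm rho -> 0 < e ->
  nbhs x [set y | rho (y - x) < e].
Proof.
move=> [rS r1] e0.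
have /nbhs0Z : scal k e != 0 :> K by rewrite gt_eqF// scal_gt0.
move=> /(_ _ _ r1) /(nbhsT x); apply: filterS => _ [_ [w /= w1 <-] <-] /=.
rewrite addrAC subrr add0r rS.2 modulus_scal gtr0_norm//.
by rewrite gtr_pMr.
Qed.

Lemma affine_continuous (a : R) (b : E) :
  continuous (fun v : E => scal k a *: v + b).
Proof.
move=> v U /nbhs_shift/ex_continuous_seminorm [rho rC rU].
have a1 : 0 < `|a| + 1 by rewrite ltr_wpDl.
have b1 : 0 < (`|a| + 1)^-1 by rewrite invr_gt0.
rewrite /nbhs /=; apply: (filterS _ (continuous_seminorm_nbhs v rC b1)).
move=> y /= yv.
have -> : scal k a *: y + b = scal k a *: v + b + scal k a *: (y - v).
  by rewrite scalerBr [RHS]addrC [RHS]addrA subrK.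
apply: rU; rewrite rC.1.2 modulus_scal.
apply: (@le_lt_trans _ _ (`|a| * (`|a| + 1)^-1)).
  by rewrite ler_wpM2l// ltW.
by rewrite ltr_pdivrMr// mul1r ltrDl.
Qed.

Lemma closed_seminorm_le rho (r : R) : continuous_seminorm rho ->
  closed [set x | rho x <= r].
Proof.
move=> rC x xcl /=; apply/ler_addgt0Pr => e e0.
have [y [/= yr yx]] := xcl _ (continuous_seminorm_nbhs x rC e0).
have := rC.1.1 y (x - y); rewrite addrC subrK => /le_trans; apply.
by rewrite -opprB (seminormN rC.1); lra.
Qed.

Lemma absolutely_convex_seminorm_le rho (r : R) : seminorm rho ->
  absolutely_convex [set x | rho x <= r].
Proof.
move=> rS x y a b /= xr yr ab.
have r0 : 0 <= r by exact: le_trans (seminorm_ge0 rS x) xr.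
rewrite (le_trans (rS.1 _ _))// !rS.2.
have ab1 : modulus a + modulus b <= 1.
  by rewrite -(ler_scal k) rmorphD rmorph1 /= !scal_modulus.
apply: (@le_trans _ _ ((modulus a + modulus b) * r)).
  by rewrite mulrDl lerD// ler_wpM2l// modulus_ge0.
by rewrite ler_piMl.
Qed.

Lemma sub_hull A : A `<=` closed_absconvex_hull A.
Proof. by move=> x Ax C [_]; apply. Qed.

Lemma closed_hull A : closed (closed_absconvex_hull A).
Proof. by apply: closed_bigI => C [[Ccl _] _]; exact: Ccl. Qed.

Lemma absolutely_convex_hull A : absolutely_convex (closed_absconvex_hull A).
Proof.
move=> x y a b xA yA ab C CA; have [[_ Ccvx] _] := CA.
exact: Ccvx (xA _ CA) (yA _ CA) ab.
Qed.

Lemma hull_sub A C : closed C -> absolutely_convex C -> A `<=` C ->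
  closed_absconvex_hull A `<=` C.
Proof. by move=> Ccl Ccvx sAC x /(_ C (conj (conj Ccl Ccvx) sAC)). Qed.

Lemma hull_seminorm_le rho A (r : R) : continuous_seminorm rho ->
  (forall x, A x -> rho x <= r) ->
  forall x, closed_absconvex_hull A x -> rho x <= r.
Proof.
move=> rC Ar; apply: hull_sub => //; first exact: closed_seminorm_le.
exact: absolutely_convex_seminorm_le rC.1.
Qed.

(** This is how boundedness passes to closed absolutely convex hulls. *)
Lemma tvs_boundedP A : tvs_bounded A <->
  forall rho, continuous_seminorm rho ->
    exists M : R, forall x, A x -> rho x <= M.
Proof.
split=> [Ab rho [rS r1]|Ab U /ex_continuous_seminorm [rho rC rU]].
  have [t t0 At] := Ab _ r1; exists (modulus t) => x /At [u /= u1 <-].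
  by rewrite rS.2 ler_piMr ?modulus_ge0 ?ltW.
have [M MA] := Ab _ rC.
have M0 : 0 < `|M| + 1 by rewrite ltr_wpDl.
exists (scal k (`|M| + 1)); first by rewrite scal_gt0.
move=> x Ax; exists (scal k (`|M| + 1)^-1 *: x).
  apply: rU; rewrite rC.1.2 modulus_scal gtr0_norm ?invr_gt0//.
  rewrite mulrC ltr_pdivrMr// mul1r (le_lt_trans (MA _ Ax))//.
  by rewrite (le_lt_trans (ler_norm _))// ltrDl.
by rewrite scalerA -rmorphM /= mulfV ?gt_eqF// rmorph1 scale1r.
Qed.

Lemma tvs_bounded_hull A : tvs_bounded A ->
  tvs_bounded (closed_absconvex_hull A).
Proof.
move=> /tvs_boundedP Ab; apply/tvs_boundedP => rho rC.
by have [M MA] := Ab _ rC; exists M; exact: hull_seminorm_le.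
Qed.

Lemma hausdorff_seminorm_eq0 x : hausdorff_space E ->
  (forall rho, continuous_seminorm rho -> rho x = 0) -> x = 0.
Proof.
move=> hE rx0; apply/esym/hE => U V U0 Vx; exists x; split.
  have [rho rC rU] := ex_continuous_seminorm U0.
  by apply: rU; rewrite rx0.
exact: nbhs_singleton.
Qed.

(** On a bounded disk each continuous seminorm has a bound [M]; if [x / t] is
    in the disk for all [t > 0] then the seminorm of [x] is at most [t * M]
    for all [t > 0]. *)
Lemma bounded_disk_linefree (D : disk E) : hausdorff_space E -> tvs_bounded D ->
  forall x, (forall t : R, 0 < t -> D (scal k t^-1 *: x)) -> x = 0.
Proof.
move=> hE /tvs_boundedP Db x Dx; apply: hausdorff_seminorm_eq0 => // rho rC.
have [M DM] := Db _ rC; apply/eqP; rewrite eq_le (seminorm_ge0 rC.1) andbT.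
apply/ler_addgt0Pr => e e0; rewrite add0r.
have M0 : 0 < `|M| + 1 by rewrite ltr_wpDl.
have t0 : 0 < e / (`|M| + 1) by rewrite divr_gt0.
have := DM _ (Dx _ t0); rewrite rC.1.2 modulus_scal gtr0_norm ?invr_gt0//.
rewrite mulrC ler_pdivrMr// => /le_trans; apply.
rewrite mulrCA ger_pMr// ler_pdivrMr// mul1r.
by rewrite (le_trans (ler_norm _))// lerDl.
Qed.

End TvsSeminorms.

(** * Limited sets *)

Section LimitedSets.
Context (R : realType) (k : scalar_kind) (E : tvsType (scalars R k)).
Local Notation K := (scalars R k).
Implicit Types (A D U : set E) (rho : E -> R) (x y : E) (p q : \bar R).
Implicit Types (f : {linear E -> K^o}) (chi : nat -> {linear E -> K^o}).

Lemma modulus_linear_seminorm f : seminorm (fun x => modulus (f x)).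
Proof.
split=> [x y|a x]; first by rewrite linearD; exact: modulusD.
by rewrite linearZ; exact: modulusM.
Qed.

Lemma modulus_linear_continuous f : continuous f ->
  continuous_seminorm (fun x => modulus (f x)).
Proof.
move=> fc; split; first exact: modulus_linear_seminorm.
have /fc : nbhs (f 0 : K^o) [set z : K^o | `|z| < 1].
  rewrite linear0; apply/nbhs_ballP; exists 1 => //= z.
  by rewrite -ball_normE /= sub0r normrN.
rewrite /nbhs /=; apply: filterS => x /=.
by rewrite -scal_modulus -(rmorph1 (@scal R k)) ltr_scal.
Qed.

Lemma dominated_equicontinuous (I : Type) (chi : I -> {linear E -> K^o}) rho :
  continuous_seminorm rho -> (forall i x, modulus (chi i x) <= rho x) ->
  equicontinuous [set: I] (fun i => chi i : E -> K^o).
Proof.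
move=> rC chir x W; rewrite -entourage_ballE => -[e /= e0 eW].
have m0 : 0 < modulus e by rewrite modulus_gt0 gt_eqF.
apply: filterS (continuous_seminorm_nbhs x rC m0) => y /= yx i _.
apply: (eW (chi i x, chi i y)); rewrite /= -ball_normE /= distrC -linearB.
rewrite -scal_modulus.
by rewrite -(gtr0_norm e0) -scal_modulus ltr_scal (le_lt_trans (chir _ _)).
Qed.

Local Open Scope ereal_scope.

Lemma dual_seminorm_ge A f x : A x -> (modulus (f x))%:E <= dual_seminorm A f.
Proof. by move=> Ax; apply: ereal_sup_ubound; exists x => //; left. Qed.

Lemma dual_seminorm_ge0 A f : 0 <= dual_seminorm A f.
Proof.
by apply: ereal_sup_ubound; exists 0%R; [right|rewrite linear0 modulus0].
Qed.

(** The set where the modulus of [f] is at most its supremum over [A] is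
    closed and absolutely convex, so it contains the hull of [A]. *)
Lemma dual_seminorm_hull_le A D f (c : R) : continuous f -> (0 <= c)%R ->
  D `<=` [set scal k c *: x | x in closed_absconvex_hull A] ->
  dual_seminorm D f <= c%:E * dual_seminorm A f.
Proof.
move=> fc c0 DA; apply: ge_ereal_sup => _ [y yD <-].
have As := dual_seminorm_ge0 A f.
case: yD => [/DA[x xA <-]|->]; last by rewrite linear0 modulus0 mule_ge0.
rewrite linearZ /= [modulus _]modulusM modulus_scal ger0_norm// EFinM.
apply: lee_wpmul2l => //.
case: (dual_seminorm A f) As (fun x => @dual_seminorm_ge A f x)
  => [s _ As|_ _|//];
  last by rewrite leey.
rewrite lee_fin; move: x xA.
apply: (hull_seminorm_le (modulus_linear_continuous fc)) => x /As.
by rewrite lee_fin.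
Qed.

Lemma limited_sub_hull p q A D (c : R) : 1 <= q -> (0 <= c)%R -> D !=set0 ->
  D `<=` [set scal k c *: x | x in closed_absconvex_hull A] ->
  limited p q A -> limited p q D.
Proof.
move=> q1 c0 D0 DA [_ Alim]; split=> // chi chic chip.
apply: (lp_or_c0_le q1 c0) (Alim chi chic chip) => n;
  try exact: dual_seminorm_ge0.
exact: dual_seminorm_hull_le.
Qed.

Lemma E_limited_sub_hull p q A D (c : R) : 1 <= q -> (0 <= c)%R -> D !=set0 ->
  D `<=` [set scal k c *: x | x in closed_absconvex_hull A] ->
  E_limited p q A -> E_limited p q D.
Proof.
move=> q1 c0 D0 DA [_ Alim]; split=> // chi chic chie chip.
apply: (lp_or_c0_le q1 c0) (Alim chi chic chie chip) => n;
  try exact: dual_seminorm_ge0.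
exact: dual_seminorm_hull_le.
Qed.

Lemma limited_E_limited p q A : limited p q A -> E_limited p q A.
Proof. by move=> [A0 Alim]; split=> // chi chic _; exact: Alim. Qed.

(** Let [rho (a n) > 2^(n+1)] with [a n] in [A].  The weights [2^-(n+1)] make
    functionals norming the points [a n] weak* summable; the weighted
    functionals are dominated by [rho], hence equicontinuous, and the one of
    index [n] still has modulus at least 1 at [a n]. *)
Lemma E_limited_bounded p q A : 1 <= p -> 1 <= q ->
  E_limited p q A -> tvs_bounded A.
Proof.
move=> p1 q1 [_ Alim]; apply/tvs_boundedP => rho rC; apply: contrapT => unb.
have ex n : exists x, A x /\ ((half_weight R n)^-1 < rho x)%R.
  apply: contrapT => /forallNP h; apply: unb.
  exists (half_weight R n)^-1%R => x Ax.
  by rewrite leNgt; apply/negP => lt; apply: (h x).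
have [a aA] := choice ex.
have [g gP] := choice (fun n => norming_functional (a n) rC.1).
have glin n : linear (fun x => (scal k (half_weight R n) * g n x)%R : K^o).
  by move=> c x y; rewrite linearP mulrDr /GRing.scale /= mulrCA.
pose chi n : {linear E -> K^o} :=
  HB.pack (fun x => (scal k (half_weight R n) * g n x)%R : K^o)
  (GRing.isLinear.Build _ _ _ _ _ (glin n)).
have chiE n x : modulus (chi n x) = (half_weight R n * modulus (g n x))%R.
  rewrite modulusM modulus_scal gtr0_norm//.
  by have /andP[] := half_weight_itv R n.
have chi_le n x : (modulus (chi n x) <= half_weight R n * rho x)%R.
  rewrite chiE ler_wpM2l ?(gP n).1// ltW//.
  by have /andP[] := half_weight_itv R n.
have chie : equicontinuous [set: nat] (fun n => chi n : E -> K^o).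
  apply: (dominated_equicontinuous rC) => n x.
  rewrite (le_trans (chi_le n x))// ler_piMl ?(seminorm_ge0 rC.1)//.
  by have /andP[] := half_weight_itv R n.
have chic : dual_sequence chi.
  by move=> n; apply: (@equicontinuous_continuous _ _ _ _ _ n chie).
have chip : weakstar_summable p chi.
  move=> x.
  apply: (lp_or_c0_le p1 (seminorm_ge0 rC.1 x) _ _ _
    (half_weight_summable p1)) => n.
  - by rewrite lee_fin modulus_ge0.
  - by rewrite lee_fin ltW//; have /andP[] := half_weight_itv R n.
  - by rewrite -EFinM lee_fin mulrC.
apply: (not_lp_or_c0 q1 _ (Alim _ chic chie chip)) => n.
apply: le_trans (dual_seminorm_ge _ (aA n).1); rewrite lee_fin chiE.
have /andP[w0 _] := half_weight_itv R n.
rewrite mulrC -ler_pdivrMr// div1r (le_trans _ (gP n).2)// ltW//.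
exact: (aA n).2.
Qed.

End LimitedSets.

(** * Inclusion and completeness of the space spanned by a bounded disk *)

Section DiskInclusion.
Context (R : realType) (k : scalar_kind) (E : tvsType (scalars R k)).
Local Notation K := (scalars R k).
Context (D : linefree_disk E) (Dbounded : tvs_bounded D).
Local Notation L := (disk_space D).

Lemma seminorm_le_gauge (rho : E -> R) (M : R) (x : L) :
  seminorm rho -> 0 <= M ->
  (forall y, D y -> rho y <= M) -> rho (val x) <= gauge D (val x) * M.
Proof.
move=> rS M0 DM; apply/ler_addgt0Pr => e e0.
pose d := e / (M + 1); have M1 : 0 < M + 1 by lra.
have d0 : 0 < d by rewrite divr_gt0.
have g0 := gauge_ge0 D (val x).
have gd0 : 0 < gauge D (val x) + d by rewrite ltr_wpDl.
have gd : gauge D (val x) < gauge D (val x) + d by rewrite ltrDl.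
have := DM _ (gauge_lt (disk_space_absorbed x) gd).
rewrite rS.2 modulus_scal gtr0_norm ?invr_gt0//.
rewrite mulrC ler_pdivrMr//.
move=> /le_trans; apply; rewrite mulrDr [M * _]mulrC lerD2l /d.
by rewrite mulrCA ger_pMr// ler_pdivrMr// mul1r; lra.
Qed.

Lemma disk_inclusion_continuous : continuous (val : L -> E).
Proof.
move=> x U /nbhs_shift/ex_continuous_seminorm [rho rC rU].
have [M0 DM0] := (tvs_boundedP _).1 Dbounded _ rC.
pose M := `|M0|; have M_ge0 : 0 <= M by exact: normr_ge0.
have DM y : D y -> rho y <= M by move=> /DM0/le_trans; apply; exact: ler_norm.
have M1 : 0 < M + 1 by lra.
apply/nbhs_ballP; exists (scal k (M + 1)^-1); rewrite /= ?scal_gt0 ?invr_gt0//.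
move=> y; rewrite -ball_normE /= -normrN opprB disk_space_normE ltr_scal => xy.
rewrite -[val y](subrK (val x)) addrC; apply: rU.
have := seminorm_le_gauge (y - x) rC.1 M_ge0 DM.
rewrite raddfB /= => /le_lt_trans; apply.
have := gauge_ge0 D (val (y - x)); rewrite raddfB /= in xy *.
have M2 : (M + 1)^-1 * (M + 1) = 1 by rewrite mulVf ?gt_eqF.
have M3 : 0 < (M + 1)^-1 by rewrite invr_gt0.
move=> g0; apply: (@le_lt_trans _ _ ((M + 1)^-1 * M)).
  by rewrite ler_wpM2r// ltW.
by rewrite -[ltRHS]M2 ltr_pM2l// ltrDl.
Qed.

Lemma disk_space_bounded_sub (B : set L) : tvs_bounded B ->
  exists2 c : R, 0 <= c & val @` B `<=` [set scal k c *: x | x in D].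
Proof.
move=> /(_ (ball (0 : L) 1)) [|t t0 Bt]; first exact: nbhsx_ballx.
exists (modulus t); first exact: modulus_ge0.
move=> _ [x /Bt [u u1 <-] <-]; exists (val u).
  apply: gauge_lt1; first exact: disk_space_absorbed.
  move: u1; rewrite /= -ball_normE /= sub0r normrN disk_space_normE.
  by rewrite -(rmorph1 (@scal R k)) ltr_scal.
by rewrite scal_modulus gtr0_norm// linearZ.
Qed.

Lemma disk_space_ball_bounded : tvs_bounded [set x : L | D (val x)].
Proof.
move=> U /nbhs_ballP [e /= e0 eU].
have m0 : 0 < modulus e by rewrite modulus_gt0 gt_eqF.
have m2 : 0 < 2 / modulus e by rewrite divr_gt0.
exists (scal k (2 / modulus e)); first by rewrite scal_gt0.
move=> x /= Dx; exists (scal k (2 / modulus e)^-1 *: x).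
  apply: eU; rewrite -ball_normE /= sub0r normrN normrZ.
  rewrite -scal_modulus modulus_scal.
  rewrite disk_space_normE -rmorphM /= -[ltRHS](gtr0_norm e0).
  rewrite -scal_modulus ltr_scal.
  rewrite gtr0_norm ?invr_gt0// invf_div.
  have := gauge_le1 Dx; have := gauge_ge0 D (val x) => g0 g1.
  apply: (@le_lt_trans _ _ (modulus e / 2)); last by lra.
  by rewrite ler_piMr// divr_ge0// ltW.
by rewrite scalerA -rmorphM /= mulfV ?gt_eqF// rmorph1 scale1r.
Qed.

End DiskInclusion.

Section DiskComplete.
Context (R : realType) (k : scalar_kind) (E : tvsType (scalars R k)).
Local Notation K := (scalars R k).
Context (D : linefree_disk E) (Dbounded : tvs_bounded D) (Dclosed : closed D).
Local Notation L := (disk_space D).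

(** The radii [4^-n / 2] make the distance between the centres of the balls of
    index [n] and [m >= n] less than [4^-n], because two members of a proper
    filter meet. *)
Lemma disk_cauchy_approx (F : set_system L) : ProperFilter F -> cauchy F ->
  exists y : nat -> L, forall n, F (ball (y n) (scal k (4^-1 ^+ n / 2))).
Proof.
move=> FF /cauchyP Fc.
have [|y yP] := @choice _ _
    (fun n y => F (ball (y : L) (scal k (4^-1 ^+ n / 2)))).
  by move=> n; apply: Fc; rewrite scal_gt0 divr_gt0// exprn_gt0.
by exists y.
Qed.

(** The rate [4^-n] leaves a factor [2^-n] to spare: the increments of the
    approximating sequence [y] are [2^-n] times the terms of a null sequence
    [z].  Local completeness, applied to [z], yields a cluster point [w] of [y]
    in [E]; since [D] is closed, [w - y n] is in [4^-n D]. *)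
Lemma disk_space_complete : locally_complete E ->
  forall F : set_system L, ProperFilter F -> cauchy F -> cvg F.
Proof.
move=> Ecomplete F FF Fc; have [y yF] := disk_cauchy_approx FF Fc.
have y_close n m : (n <= m)%N -> gauge D (val (y m - y n)) < 4^-1 ^+ n.
  move=> nm; have [w [wn wm]] := filter_ex (filterI (yF n) (yF m)).
  rewrite -(ltr_scal k) -disk_space_normE.
  move: wn wm; rewrite -ball_normE /= => wn wm.
  rewrite -(subrKA w) -[y m - w]/(y m - w) (le_lt_trans (ler_normD _ _))//.
  rewrite [ltRHS](_ : _ = scal k (4^-1 ^+ n / 2) + scal k (4^-1 ^+ n / 2)).
    rewrite ltrD//; last by rewrite distrC.
    rewrite (lt_le_trans wm)// ler_scal ler_pM2r//.
    by rewrite ler_wiXn2l// ?invr_ge0// invf_le1// ler1n.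
  by rewrite -rmorphD -splitr.
pose z n : L := scal k (2 ^+ n) *: (y n.+1 - y n).
have z_cvg : (val \o z) @ \oo --> (0 : E).
  have z0 : z @ \oo --> (0 : L); last first.
    have := continuous_cvg _
      (@disk_inclusion_continuous _ _ _ D Dbounded (0 : L)) z0.
    by rewrite raddf0; exact.
  apply/cvgr0Pnorm_lt => e e0.
  have m0 : 0 < modulus e by rewrite modulus_gt0 gt_eqF.
  have half1 : `|2^-1 : R| < 1 by rewrite gtr0_norm ?invr_gt0// invf_lt1 ?ltr1n.
  have hn : \forall n \near \oo, `|(2^-1 : R) ^+ n| < modulus e.
    by apply: cvgr0_norm_lt => //; exact: cvg_expr.
  apply: filterS hn => n /= n_lt; rewrite normrZ -scal_modulus modulus_scal.
  rewrite disk_space_normE -rmorphM /= -[ltRHS](gtr0_norm e0).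
  rewrite -scal_modulus ltr_scal.
  apply: le_lt_trans n_lt; rewrite !ger0_norm ?exprn_ge0 ?invr_ge0//.
  have -> : (2^-1 : R) ^+ n = 2 ^+ n * 4^-1 ^+ n.
    by rewrite -exprMn; congr (_ ^+ _); field.
  by rewrite ler_wpM2l ?exprn_ge0// ltW// y_close.
pose H := closed_absconvex_hull (range (val \o z)).
have Hz n : H (val (z n)) by apply: sub_hull; exists n.
have Hcvx := @absolutely_convex_hull R k E (range (val \o z)).
have h2 : `|scal k 2^-1| + `|scal k 2^-1| <= 1 :> K.
  rewrite -!scal_modulus !modulus_scal -rmorphD /= ger0_norm ?invr_ge0//.
  by rewrite -(rmorph1 (@scal R k)) ler_scal; lra.
(* the case [h = 0] says that half of a partial sum lies in [H]; a general [h]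
   makes the induction work, the last term being absorbed into [h] *)
have Hsum m h : H h ->
    H (scal k 2^-1 *: (val (y m) - val (y 0%N)) + scal k (2^-1 ^+ m) *: h).
  elim: m h => [|m IH] h Hh.
    by rewrite subrr scaler0 add0r expr0 rmorph1 scale1r.
  rewrite (_ : _ + _ = scal k 2^-1 *: (val (y m) - val (y 0%N)) +
      scal k (2^-1 ^+ m) *: (scal k 2^-1 *: val (z m) + scal k 2^-1 *: h)).
    exact: IH _ (Hcvx _ _ _ _ (Hz m) Hh h2).
  rewrite [X in _ = _ + X]scalerDr addrA; congr (_ + _).
    rewrite /z linearZ /= !scalerA -!rmorphM /=.
    have -> : 2^-1 * (2^-1 : R) ^+ m * 2 ^+ m = 2^-1.
      by rewrite -mulrA -exprMn mulVf ?pnatr_eq0// expr1n mulr1.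
    by rewrite -scalerDr [X in _ = _ *: X]addrC subrKA.
  by rewrite scalerA -rmorphM /= exprSr.
pose hs m : E := scal k 2^-1 *: (val (y m) - val (y 0%N)).
have Hhs m : H (hs m).
  have H0 : H 0.
    have := Hcvx _ _ 0 0 (Hz 0%N) (Hz 0%N); rewrite !scale0r addr0; apply.
    by rewrite normr0 addr0.
  by have := Hsum m 0 H0; rewrite scaler0 addr0.
have [|c [Hc cclu]] := Ecomplete _ z_cvg (hs @ \oo) _.
  by exists 0%N => // m _; exact: Hhs.
(* [hs] is the sequence [y], recentred at its first term and halved: [w]
   undoes this *)
pose w := scal k 2 *: c + val (y 0%N).
(* the points [hs m] with [m >= n] lie in a closed set, hence so does their
   cluster point *)
have w_close n : D (scal k (4 ^+ n) *: (w - val (y n))).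
  have C_closed : closed [set v : E |
      D (scal k (4 ^+ n) *: (scal k 2 *: v + val (y 0%N) - val (y n)))].
    pose f := (fun v : E => scal k (4 ^+ n) *: v + 0) \o
      (fun v : E => scal k 2 *: v + (val (y 0%N) - val (y n))).
    rewrite (_ : [set v | _] = f @^-1` D).
      apply: preimage_closed => // v _.
      by apply: continuous_comp; exact: affine_continuous.
    by apply/seteqP; split=> v; rewrite /f /= addr0 addrA.
  apply: C_closed => V cV; apply: cclu; last exact: cV.
  exists n => // m /= nm.
  have -> : scal k 2 *: hs m + val (y 0%N) - val (y n) = val (y m - y n).
    by rewrite /hs scalerA -rmorphM /= mulfV// rmorph1 scale1r subrK.
  have := gauge_lt (disk_space_absorbed _) (y_close n m nm).
  by rewrite -exprVn invrK.
have w_abs : w \in disk_span D.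
  apply/disk_spanP; rewrite -(subrK (val (y 0%N)) w).
  apply: absorbedD; last exact: disk_space_absorbed.
  by exists 1 => //; have := w_close 0%N; rewrite expr0 invr1.
pose u : L := Sub w w_abs.
have u_close n : gauge D (val (u - y n)) <= 4^-1 ^+ n.
  apply: gauge_le => //; rewrite -exprVn invrK; exact: w_close.
apply/cvg_ex; exists u; apply/fcvg_ballP => e e0.
have m0 : 0 < modulus e / 2.
  by rewrite divr_gt0// modulus_gt0 gt_eqF.
have q1 : `|4^-1 : R| < 1 by rewrite gtr0_norm ?invr_gt0// invf_lt1 ?ltr1n.
have hn : \forall n \near \oo, `|(4^-1 : R) ^+ n| < modulus e / 2.
  by apply: cvgr0_norm_lt => //; exact: cvg_expr.
have [n /= n_lt] := filter_ex hn.
apply: filterS (yF n) => v; rewrite -!ball_normE /= => yv.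
rewrite -(subrKA (y n)) (le_lt_trans (ler_normD _ _))//.
rewrite -(gtr0_norm e0) -[in ltRHS]scal_modulus [modulus e]splitr rmorphD /=.
rewrite ger0_norm ?exprn_ge0 ?invr_ge0// in n_lt.
apply: ler_ltD.
  by rewrite disk_space_normE ler_scal (le_trans (u_close n))// ltW.
rewrite (lt_trans yv)// ltr_scal (le_lt_trans _ n_lt)//.
by rewrite ler_pdivrMr// ler_peMr ?ler1n// exprn_ge0// invr_ge0.
Qed.

End DiskComplete.

(** * Operators into the space *)

Section Equivalence.
Context (R : realType) (k : scalar_kind) (E : tvsType (scalars R k)).
Context (hE : hausdorff_space E) (lim : set E -> Prop).
Context (lim_nonempty : forall A, lim A -> A !=set0).
Context (lim_bounded : forall A, lim A -> tvs_bounded A).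
Context (lim_sub_hull : forall A D (c : R), 0 <= c -> D !=set0 ->
  D `<=` [set scal k c *: x | x in closed_absconvex_hull A] -> lim A -> lim D).

Lemma hull_disk (A : set E) : A !=set0 -> tvs_bounded A ->
  exists2 D : linefree_disk E,
    (D : set E) = closed_absconvex_hull A & tvs_bounded D.
Proof.
move=> [a Aa] /tvs_bounded_hull Hb.
pose D := Disk (ex_intro _ a (sub_hull Aa)) (@absolutely_convex_hull _ _ _ A).
by exists (LinefreeDisk (bounded_disk_linefree hE (Hb : tvs_bounded D))).
Qed.

Lemma disk_inclusion_limited (A : set E) (D : linefree_disk E) :
  (D : set E) = closed_absconvex_hull A -> lim A ->
  maps_bounded_to lim (val : disk_space D -> E).
Proof.
move=> DA limA B [b Bb] /disk_space_bounded_sub [c c0]; rewrite DA => Bc.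
by apply: lim_sub_hull Bc limA => //; exists (val b), b.
Qed.

Lemma disk_totally_bounded (A : set E) (D : linefree_disk E) : A !=set0 ->
  (D : set E) = closed_absconvex_hull A ->
  maps_bounded_to totally_bounded (val : disk_space D -> E) ->
  totally_bounded A.
Proof.
move=> [a Aa] DA valt U U0.
have AD x : A x -> D x.
  by move=> Ax; rewrite -[D x]/((D : set E) x) DA; exact: sub_hull.
have D_abs x : D x -> x \in disk_span D.
  by move=> Dx; apply/disk_spanP; exists 1; rewrite // invr1 rmorph1 scale1r.
have [|F Ffin FU] := valt [set x : disk_space D | D (val x)] _
    (@disk_space_ball_bounded _ _ _ D) U U0.
  by have aD := D_abs _ (AD _ Aa); exists (Sub a aD); exact: AD.
by exists F => // x /AD Dx; apply: FU; exists (Sub x (D_abs _ Dx)).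
Qed.

Lemma sets_lcs_operators_precompact :
  sets_precompact lim -> lcs_operators_precompact lim.
Proof. by move=> limtb L T _ _ Tlim B B0 Bb; apply: limtb; exact: Tlim. Qed.

Lemma lcs_normed_operators_precompact :
  lcs_operators_precompact lim -> normed_operators_precompact lim.
Proof. by move=> h L T; apply: h; exact: norm_hausdorff. Qed.

Lemma normed_banach_operators_precompact :
  normed_operators_precompact lim -> banach_operators_precompact lim.
Proof. by move=> h L T; exact: h. Qed.

Lemma normed_operators_sets_precompact :
  normed_operators_precompact lim -> sets_precompact lim.
Proof.
move=> h A limA.
have [D DA Db] := hull_disk (lim_nonempty limA) (lim_bounded limA).
apply: (disk_totally_bounded (lim_nonempty limA) DA).
apply: (h (disk_space D) (val : {linear disk_space D -> E})).
  exact: disk_inclusion_continuous.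
exact: disk_inclusion_limited DA limA.
Qed.

Lemma banach_operators_sets_precompact : locally_complete E ->
  banach_operators_precompact lim -> sets_precompact lim.
Proof.
move=> Ecomplete h A limA.
have [D DA Db] := hull_disk (lim_nonempty limA) (lim_bounded limA).
apply: (disk_totally_bounded (lim_nonempty limA) DA).
have Dclosed : closed (D : set E) by rewrite DA; exact: closed_hull.
pose L : completeNormedModType (scalars R k) := HB.pack (disk_space D)
  (Uniform_isComplete.Build (disk_space D)
    (disk_space_complete Db Dclosed Ecomplete)).
apply: (h L (val : {linear disk_space D -> E})).
  exact: disk_inclusion_continuous.
exact: disk_inclusion_limited DA limA.
Qed.

Lemma tfae_operators_precompact :
  [<-> sets_precompact lim; lcs_operators_precompact lim;
       normed_operators_precompact lim] /\
  (locally_complete E ->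
   [<-> sets_precompact lim; lcs_operators_precompact lim;
        normed_operators_precompact lim; banach_operators_precompact lim]).
Proof.
split=> [|Ecomplete]; tfae.
- exact: sets_lcs_operators_precompact.
- exact: lcs_normed_operators_precompact.
- exact: normed_operators_sets_precompact.
- exact: sets_lcs_operators_precompact.
- exact: lcs_normed_operators_precompact.
- exact: normed_banach_operators_precompact.
- exact: banach_operators_sets_precompact.
Qed.

End Equivalence.

Theorem theorem3p11 (R : realType) (k : scalar_kind) (p q : \bar R)
    (hp : (1%:E <= p)%E) (hpq : (p <= q)%E)
    (E : tvsType (scalars R k)) (hE : hausdorff_space E) :
  ([<-> sets_precompact (limited (E := E) p q);
        lcs_operators_precompact (limited (E := E) p q);
        normed_operators_precompact (limited (E := E) p q)] /\
   (locally_complete E ->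
    [<-> sets_precompact (limited (E := E) p q);
         lcs_operators_precompact (limited (E := E) p q);
         normed_operators_precompact (limited (E := E) p q);
         banach_operators_precompact (limited (E := E) p q)])) /\
  ([<-> sets_precompact (E_limited (E := E) p q);
        lcs_operators_precompact (E_limited (E := E) p q);
        normed_operators_precompact (E_limited (E := E) p q)] /\
   (locally_complete E ->
    [<-> sets_precompact (E_limited (E := E) p q);
         lcs_operators_precompact (E_limited (E := E) p q);
         normed_operators_precompact (E_limited (E := E) p q);
         banach_operators_precompact (E_limited (E := E) p q)])).
Proof.
have hq : (1%:E <= q)%E := le_trans hp hpq.
split; apply: tfae_operators_precompact => //.
- by move=> A [].
- by move=> A /limited_E_limited; exact: E_limited_bounded.
- by move=> A D c c0 D0 DA; exact: limited_sub_hull DA.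
- by move=> A [].
- by move=> A; exact: E_limited_bounded.
- by move=> A D c c0 D0 DA; exact: E_limited_sub_hull DA.
Qed.
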